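(* Let $(X_i,Y_i)$, $i=1,\dots,n$, follow the trace regression model $Y_i=\mathrm{tr}(X_i^\top A_0)+\xi_i$ with unknown $A_0\in\mathbb R^{m_1\times m_2}$. Let $r\ge 1$ be an integer with $\mathrm{rank}(A_0)\le r$, let $\alpha>1$, assume $\kappa_1=\kappa_1(\Pi)>0$, and assume $$\rho(\Pi)\le \frac{\kappa_1^2}{11\,\alpha\, r}.$$ Let $\lambda>0$ and let $\hat A^\lambda$ be the estimator $$\hat A^{\lambda}=\mathrm{argmin}_{A\in\mathbb R^{m_1\times m_2}}\Big\{\|A\|_{L_2(\Pi)}^2-\Big\langle \frac2n\sum_{i=1}^nY_iX_i,\,A\Big\rangle+\lambda\|A\|_1\Big\}.$$ Then, on the event $\{\lambda\ge 3\|\mathbf M_1+\mathbf M_2\|_\infty\}$, $$\|\hat A^\lambda-A_0\|_\infty\le\Big(\frac56+\frac{6\sqrt2}{11(\alpha-1)}\Big)\frac{\lambda}{\kappa_1^2}.$$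
   Context: Model: $(X_i,Y_i)$, $i=1,\dots,n$, are independent observations; $X_i$ are random $m_1\times m_2$ real matrices (not necessarily identically distributed; second moments of $\langle A,X_i\rangle$ are finite for all $A$), and $\xi_i$ are i.i.d. zero-mean real random variables with finite variance. Notation: $\langle A,B\rangle=\mathrm{tr}(A^\top B)$; $\|A\|_1,\|A\|_2,\|A\|_\infty$ are the Schatten norms, i.e. the nuclear, Frobenius and spectral norm, respectively. $\Pi=\frac1n\sum_{i=1}^n\Pi_i$ where $\Pi_i$ is the distribution of $X_i$, and $$\langle A,B\rangle_{L_2(\Pi)}=\frac1n\sum_{i=1}^n\mathbb E\big(\langle A,X_i\rangle\langle B,X_i\rangle\big),\qquad \|A\|_{L_2(\Pi)}^2=\langle A,A\rangle_{L_2(\Pi)}.$$ $\kappa_1(\Pi)=\inf\{\|B\|_{L_2(\Pi)}:B\in\mathbb R^{m_1\times m_2},\ \|B\|_2=1,\ \mathrm{rank}(B)\le1\}$. Coherence: $\rho(\Pi)=\sup\Big\{\frac{|\langle A,B\rangle_{L_2(\Pi)}|}{\|A\|_1\|B\|_1}: A,B\in\mathbb R^{m_1\times m_2}\ \text{nonzero},\ \langle A,B\rangle=0\Big\}$. Stochastic error matrices: $$\mathbf M_1=\frac1n\sum_{i=1}^n\xi_iX_i,\qquad \mathbf M_2=\frac1n\sum_{i=1}^n\Big(\langle A_0,X_i\rangle X_i-\mathbb E\big(\langle A_0,X_i\rangle X_i\big)\Big).$$ *)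

(* Defs.v *)
From HB Require Import structures.
From mathcomp Require Import all_boot all_order all_algebra.
From mathcomp Require Import all_classical all_reals all_analysis.
Set Implicit Arguments.
Unset Strict Implicit.
Unset Printing Implicit Defensive.
Import Order.TTheory GRing.Theory Num.Theory.
Import numFieldNormedType.Exports.
Local Open Scope classical_set_scope.
Local Open Scope ring_scope.

Definition mxdot (R : realType) (m1 m2 : nat) (A B : 'M[R]_(m1, m2)) : R :=
  \tr (A^T *m B).

(* The eigenvalues of B in decreasing order, counted with algebraic
   multiplicity.  The sequence exists whenever the characteristic polynomial
   splits over R, in particular for symmetric B, the only case used below;
   the default [::] is then never reached. *)
Definition eigenvalues (R : realType) (n : nat) (B : 'M[R]_n) : seq R :=
  xget [::] [set s : seq R | sorted >=%R s /\
                             char_poly B = \prod_(x <- s) ('X - x%:P)].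

(* There are m2 entries: if m1 < m2, the min(m1, m2) usual singular values are
   padded with zeros, which affects none of the norms below. *)
Definition singular_values (R : realType) (m1 m2 : nat) (A : 'M[R]_(m1, m2)) :
    seq R :=
  [seq Num.sqrt x | x <- eigenvalues (A^T *m A)].

Definition nuclear_norm (R : realType) (m1 m2 : nat) (A : 'M[R]_(m1, m2)) : R :=
  \sum_(s <- singular_values A) s.

Definition frobenius_norm (R : realType) (m1 m2 : nat) (A : 'M[R]_(m1, m2)) :
    R :=
  Num.sqrt (mxdot A A).

Definition spectral_norm (R : realType) (m1 m2 : nat) (A : 'M[R]_(m1, m2)) : R :=
  \big[Num.max/0]_(s <- singular_values A) s.

Definition mutually_independent d (T : measurableType d) (R : realType)
    (P : probability T R) (n : nat) (F : 'I_n -> set (set T)) : Prop :=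
  forall (J : {set 'I_n}) (B : 'I_n -> set T),
    (forall i, i \in J -> F i (B i)) ->
    P (\bigcap_(i in [set` J]) B i) = (\prod_(i in J) P (B i))%E.

(* The sigma-algebra generated by (X, Y): matrices carry no measurable
   structure in the library, so X is observed through its entries. *)
Definition sigma_pair d (T : measurableType d) (R : realType) (m1 m2 : nat)
    (X : T -> 'M[R]_(m1, m2)) (Y : T -> R) : set (set T) :=
  <<s (\bigcup_(jk in [set: 'I_m1 * 'I_m2])
         preimage_set_system setT (fun w => X w jk.1 jk.2) measurable)
      `|` preimage_set_system setT Y measurable >>.

Definition iid d (T : measurableType d) (R : realType) (P : probability T R)
    (n : nat) (xi : 'I_n -> {RV P >-> R}) : Prop :=
  mutually_independent P (fun i => g_sigma_algebra_preimage (xi i)) /\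
  forall (i j : 'I_n) (U : set R), measurable U ->
    distribution P (xi i) U = distribution P (xi j) U.

(* In the definitions below, Pi is the average of the distributions of the
   X i under P. *)

Definition L2dot d (T : measurableType d) (R : realType) (P : probability T R)
    (n m1 m2 : nat) (X : 'I_n -> T -> 'M[R]_(m1, m2)) (A B : 'M[R]_(m1, m2)) :
    R :=
  n%:R^-1 *
  \sum_(i < n) fine 'E_P[(fun w => mxdot A (X i w) * mxdot B (X i w))].

Definition L2norm d (T : measurableType d) (R : realType) (P : probability T R)
    (n m1 m2 : nat) (X : 'I_n -> T -> 'M[R]_(m1, m2)) (A : 'M[R]_(m1, m2)) : R :=
  Num.sqrt (L2dot P X A A).

Definition kappa1 d (T : measurableType d) (R : realType) (P : probability T R)
    (n m1 m2 : nat) (X : 'I_n -> T -> 'M[R]_(m1, m2)) : R :=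
  inf [set L2norm P X B | B in
        [set B : 'M[R]_(m1, m2) | frobenius_norm B = 1 /\ (\rank B <= 1)%N]].

(* The supremum is taken in the extended reals; it is -oo when m1 = m2 = 1,
   since there the set is empty. *)
Definition coherence d (T : measurableType d) (R : realType)
    (P : probability T R) (n m1 m2 : nat) (X : 'I_n -> T -> 'M[R]_(m1, m2)) :
    \bar R :=
  ereal_sup
    [set (`|L2dot P X AB.1 AB.2|
            / (nuclear_norm AB.1 * nuclear_norm AB.2))%:E | AB in
      [set AB : 'M[R]_(m1, m2) * 'M[R]_(m1, m2) |
        [/\ AB.1 != 0, AB.2 != 0 & mxdot AB.1 AB.2 = 0]]].

Definition noise_matrix1 (T : Type) (R : realType) (n m1 m2 : nat)
    (X : 'I_n -> T -> 'M[R]_(m1, m2)) (xi : 'I_n -> T -> R) (w : T) :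
    'M[R]_(m1, m2) :=
  n%:R^-1 *: \sum_(i < n) xi i w *: X i w.

Definition noise_matrix2 d (T : measurableType d) (R : realType)
    (P : probability T R) (n m1 m2 : nat) (X : 'I_n -> T -> 'M[R]_(m1, m2))
    (A0 : 'M[R]_(m1, m2)) (w : T) : 'M[R]_(m1, m2) :=
  n%:R^-1 *: \sum_(i < n)
    (mxdot A0 (X i w) *: X i w -
     \matrix_(j, k) fine 'E_P[(fun v => (mxdot A0 (X i v) *: X i v) j k)]).

Definition penalized_risk d (T : measurableType d) (R : realType)
    (P : probability T R) (n m1 m2 : nat) (X : 'I_n -> T -> 'M[R]_(m1, m2))
    (Y : 'I_n -> T -> R) (lambda : R) (w : T) (A : 'M[R]_(m1, m2)) : R :=
  L2norm P X A ^+ 2 - mxdot ((2 / n%:R) *: \sum_(i < n) Y i w *: X i w) A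
    + lambda * nuclear_norm A.

Definition is_argmin (S : Type) (R : realType) (f : S -> R) (a : S) : Prop :=
  forall b, f a <= f b.

(* Main.v *)
(* Write k = kappa1, s for the spectral norm of H = Ahat - A0, and let u v^T
   (with s u = H v) be a top singular component of H.  Perturbing Ahat in the
   direction - u v^T gives <H, u v^T>_L2 <= 5 lambda / 6.  Splitting
   H = s u v^T + H (1 - v v^T), where the second term is orthogonal to u v^T and
   has nuclear norm at most that of H, coherence yields
   s k^2 <= 5 lambda / 6 + rho |H|_1.  Comparing Ahat with A0 in the objective
   gives |Ahat|_1 <= |A0|_1 + 2/3 |H|_1, and decomposability of the nuclear norm
   at A0 turns this into |H|_1 <= 9 r s.  The inequality for s is then
   self-bounding, with factor 9 / (11 alpha) < 1; no bound on the Frobenius norm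
   of H is needed.  The duality of nuclear and spectral norms rests on the
   spectral theorem, obtained from a real eigenvector (taken from an eigenvector
   over R[i]) and deflation by a Householder reflection. *)
Require Import Defs.
From HB Require Import structures.
From mathcomp Require Import all_boot all_order all_algebra.
From mathcomp Require Import all_classical all_reals all_analysis.
From mathcomp Require Import complex ring lra measurable_realfun.
Import Order.TTheory GRing.Theory Num.Theory.
Import numFieldNormedType.Exports.
Local Open Scope classical_set_scope.
Local Open Scope ring_scope.
Set Implicit Arguments.
Unset Strict Implicit.
Unset Printing Implicit Defensive.

(** * The trace inner product on real matrices *)

Section FrobeniusInnerProduct.
Variable R : realType.
Implicit Types m n p : nat.

Lemma mxdotE m n (A B : 'M[R]_(m, n)) :
  mxdot A B = \sum_i \sum_j A i j * B i j.
Proof.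
rewrite /mxdot /mxtrace exchange_big; apply: eq_bigr => j _.
by rewrite mxE; apply: eq_bigr => i _; rewrite mxE.
Qed.

Lemma mxdotC m n (A B : 'M[R]_(m, n)) : mxdot A B = mxdot B A.
Proof.
by rewrite !mxdotE; apply: eq_bigr => i _; apply: eq_bigr => j _; rewrite mulrC.
Qed.

Lemma mxdot_tr m n (A B : 'M[R]_(m, n)) : mxdot A^T B^T = mxdot A B.
Proof. by rewrite /mxdot trmxK mxtrace_mulC -mxtrace_tr trmx_mul trmxK. Qed.

Lemma mxdotDr m n (A B C : 'M[R]_(m, n)) : mxdot A (B + C) = mxdot A B + mxdot A C.
Proof. by rewrite /mxdot mulmxDr mxtraceD. Qed.

Lemma mxdotZr m n a (A B : 'M[R]_(m, n)) : mxdot A (a *: B) = a * mxdot A B.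
Proof. by rewrite /mxdot -scalemxAr mxtraceZ. Qed.

Lemma mxdotNr m n (A B : 'M[R]_(m, n)) : mxdot A (- B) = - mxdot A B.
Proof. by rewrite -scaleN1r mxdotZr mulN1r. Qed.

Lemma mxdotBr m n (A B C : 'M[R]_(m, n)) : mxdot A (B - C) = mxdot A B - mxdot A C.
Proof. by rewrite mxdotDr mxdotNr. Qed.

Lemma mxdot0r m n (A : 'M[R]_(m, n)) : mxdot A 0 = 0.
Proof. by rewrite -(scale0r 0) mxdotZr mul0r. Qed.

Lemma mxdotDl m n (A B C : 'M[R]_(m, n)) : mxdot (B + C) A = mxdot B A + mxdot C A.
Proof. by rewrite mxdotC mxdotDr !(mxdotC A). Qed.

Lemma mxdotZl m n a (A B : 'M[R]_(m, n)) : mxdot (a *: B) A = a * mxdot B A.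
Proof. by rewrite mxdotC mxdotZr mxdotC. Qed.

Lemma mxdotNl m n (A B : 'M[R]_(m, n)) : mxdot (- B) A = - mxdot B A.
Proof. by rewrite mxdotC mxdotNr mxdotC. Qed.

Lemma mxdotBl m n (A B C : 'M[R]_(m, n)) : mxdot (B - C) A = mxdot B A - mxdot C A.
Proof. by rewrite mxdotDl mxdotNl. Qed.

Lemma mxdot0l m n (A : 'M[R]_(m, n)) : mxdot 0 A = 0.
Proof. by rewrite mxdotC mxdot0r. Qed.

Lemma mxdot_sumr m n I (s : seq I) (Q : pred I) (A : 'M[R]_(m, n)) F :
  mxdot A (\sum_(i <- s | Q i) F i) = \sum_(i <- s | Q i) mxdot A (F i).
Proof.
exact: (big_morph (mxdot A) (fun B C => mxdotDr A B C) (mxdot0r A)).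
Qed.

Lemma mxdot_suml m n I (s : seq I) (Q : pred I) (A : 'M[R]_(m, n)) F :
  mxdot (\sum_(i <- s | Q i) F i) A = \sum_(i <- s | Q i) mxdot (F i) A.
Proof.
by rewrite mxdotC mxdot_sumr; apply: eq_bigr => i _; rewrite mxdotC.
Qed.

Lemma mxdot_mull m n p (C : 'M[R]_(m, n)) (A : 'M[R]_(n, p)) B :
  mxdot (C *m A) B = mxdot A (C^T *m B).
Proof. by rewrite /mxdot trmx_mul mulmxA. Qed.

Lemma mxdot_mulr m n p (C : 'M[R]_(n, p)) (A : 'M[R]_(m, n)) B :
  mxdot (A *m C) B = mxdot A (B *m C^T).
Proof. by rewrite /mxdot trmx_mul -mulmxA mxtrace_mulC mulmxA. Qed.

Lemma mxdot_ge0 m n (A : 'M[R]_(m, n)) : 0 <= mxdot A A.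
Proof.
by rewrite mxdotE; apply: sumr_ge0 => i _; apply: sumr_ge0 => j _; rewrite -expr2 sqr_ge0.
Qed.

Lemma mxdot_eq0 m n (A : 'M[R]_(m, n)) : (mxdot A A == 0) = (A == 0).
Proof.
apply/eqP/eqP => [|->]; last exact: mxdot0r.
have ge0 i j : 0 <= A i j * A i j by rewrite -expr2 sqr_ge0.
rewrite mxdotE => /eqP; rewrite psumr_eq0 => [/allP /= h|i _]; last exact: sumr_ge0.
apply/matrixP => i j; rewrite mxE; have := h i (mem_index_enum _).
rewrite psumr_eq0 // => /allP /(_ j (mem_index_enum _)) /=.
by rewrite mulf_eq0 orbb => /eqP.
Qed.

Lemma mxdot_gt0 m n (A : 'M[R]_(m, n)) : (0 < mxdot A A) = (A != 0).
Proof. by rewrite lt_def mxdot_ge0 andbT mxdot_eq0. Qed.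

(** Expand [0 <= |b A - a B|^2] and divide by [a b], the cases [a = 0] and [b = 0] being apart.
    Stated with bounds [a], [b] on the norms, it applies without square roots. *)
Lemma mxdot_cauchy_schwarz m n (A B : 'M[R]_(m, n)) (a b : R) :
  0 <= a -> 0 <= b -> mxdot A A <= a ^+ 2 -> mxdot B B <= b ^+ 2 ->
  mxdot A B <= a * b.
Proof.
move=> a_ge0 b_ge0 Aa Bb.
have [a0|a_neq0] := eqVneq a 0.
  move: Aa; rewrite a0 expr0n /= => Aa.
  have /eqP : mxdot A A == 0 by rewrite eq_le Aa mxdot_ge0.
  by move/eqP; rewrite mxdot_eq0 => /eqP ->; rewrite mxdot0l mul0r.
have [b0|b_neq0] := eqVneq b 0.
  move: Bb; rewrite b0 expr0n /= => Bb.
  have /eqP : mxdot B B == 0 by rewrite eq_le Bb mxdot_ge0.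
  by move/eqP; rewrite mxdot_eq0 => /eqP ->; rewrite mxdot0r mulr0.
have a_gt0 : 0 < a by rewrite lt_def a_neq0.
have b_gt0 : 0 < b by rewrite lt_def b_neq0.
have ab_gt0 := mulr_gt0 a_gt0 b_gt0.
have := mxdot_ge0 (b *: A - a *: B).
rewrite !(mxdotBl, mxdotBr, mxdotZl, mxdotZr) (mxdotC B A).
move=> h.
have h1 : b ^+ 2 * mxdot A A <= b ^+ 2 * a ^+ 2 by rewrite ler_wpM2l ?sqr_ge0.
have h2 : a ^+ 2 * mxdot B B <= a ^+ 2 * b ^+ 2 by rewrite ler_wpM2l ?sqr_ge0.
rewrite -(ler_pM2l ab_gt0); nra.
Qed.

Lemma scalar_mxdot m (x y : 'cV[R]_m) : x^T *m y = (mxdot x y)%:M.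
Proof. by rewrite [LHS]mx11_scalar /mxdot /mxtrace big_ord1. Qed.

End FrobeniusInnerProduct.

(** * Orthogonal diagonalization of real symmetric matrices *)

Section RealSpectralTheorem.
Variable R : realType.

(** A complex eigenvector is split into real and imaginary parts [a], [b]. Symmetry makes the
    eigenvalue real, so whichever part is nonzero is a real eigenvector. *)
Lemma symmetric_eigenvector n (B : 'M[R]_n.+1) : B^T = B ->
  exists (a : R) (v : 'cV[R]_n.+1), mxdot v v = 1 /\ B *m v = a *: v.
Proof.
move=> B_sym.
pose f : {rmorphism R -> R[i]} := real_complex R.
have /closed_rootP [z] : size (char_poly (map_mx f B)) != 1%N by rewrite size_char_poly.
rewrite -eigenvalue_root_char => /eigenvalueP [w wB w_neq0].
pose a := map_mx (@complex.Re R) w; pose b := map_mx (@complex.Im R) w.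
have aB : a *m B = complex.Re z *: a - complex.Im z *: b.
  apply/rowP => j; have /rowP /(_ j) /(congr1 (@complex.Re R)) := wB.
  rewrite !mxE raddf_sum /= => e.
  transitivity (\sum_i complex.Re (w 0 i * (map_mx f B) i j)).
    apply: eq_bigr => i _; rewrite !mxE; case: (w 0 i) => x y /=.
    by rewrite mulr0 subr0.
  by rewrite e; case: (z) => x y; case: (w 0 j).
have bB : b *m B = complex.Re z *: b + complex.Im z *: a.
  apply/rowP => j; have /rowP /(_ j) /(congr1 (@complex.Im R)) := wB.
  rewrite !mxE raddf_sum /= => e.
  transitivity (\sum_i complex.Im (w 0 i * (map_mx f B) i j)).
    apply: eq_bigr => i _; rewrite !mxE; case: (w 0 i) => x y /=.
    by rewrite mulr0 add0r.
  by rewrite e; case: (z) => x y; case: (w 0 j).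
have ab_neq0 : (a != 0) || (b != 0).
  rewrite -negb_and; apply: contra w_neq0 => /andP [/eqP a0 /eqP b0].
  apply/eqP/rowP => j; move/rowP/(_ j): a0; move/rowP/(_ j): b0; rewrite !mxE.
  by case: (w 0 j) => x y /= -> ->.
(* Equating [<a B, b>] and [<a, b B>] leaves [Im z (|a|^2 + |b|^2) = 0]. *)
have z_real : complex.Im z = 0.
  have : mxdot (a *m B) b = mxdot a (b *m B) by rewrite mxdot_mulr B_sym.
  rewrite aB bB mxdotBl mxdotDr !mxdotZl !mxdotZr => e.
  have {e} : complex.Im z * (mxdot a a + mxdot b b) = 0 by lra.
  move/eqP; rewrite mulf_eq0 => /orP [/eqP //|].
  rewrite paddr_eq0 ?mxdot_ge0 // !mxdot_eq0 => /andP [a0 b0].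
  by rewrite a0 b0 in ab_neq0.
have [c cB c_neq0] : exists2 c : 'rV[R]_n.+1, c *m B = complex.Re z *: c & c != 0.
  move: aB bB; rewrite z_real !scale0r subr0 addr0 => aB bB.
  by case/orP: ab_neq0 => ?; [exists a|exists b].
have c_gt0 : 0 < mxdot c c by rewrite mxdot_gt0.
exists (complex.Re z), ((Num.sqrt (mxdot c c))^-1 *: c^T); split.
  rewrite mxdotZl mxdotZr mxdot_tr mulrA -invfM -expr2 sqr_sqrtr ?mxdot_ge0 //.
  by rewrite mulVf ?gt_eqF.
rewrite -scalemxAr -[B in B *m _]B_sym -trmx_mul cB linearZ /=.
by rewrite !scalerA mulrC.
Qed.

(** The Householder reflection along [w = e - v] swaps the unit vectors [e] and [v]; it is a
    symmetric involution. *)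
Lemma orthogonal_first_column n (v : 'cV[R]_n.+1) : mxdot v v = 1 ->
  exists Q : 'M[R]_n.+1, [/\ Q^T = Q, Q *m Q = 1%:M & Q *m delta_mx 0 0 = v].
Proof.
move=> v1; pose e : 'cV[R]_n.+1 := delta_mx 0 0.
have e1 : mxdot e e = 1.
  rewrite /mxdot /e trmx_delta mul_delta_mx /mxtrace big_ord1 mxE eqxx //.
have [<-|ve] := eqVneq e v.
  by exists 1%:M; rewrite trmx1 mulmx1 mul1mx; split.
pose w := e - v; pose c := 2 / mxdot w w.
have w_gt0 : 0 < mxdot w w by rewrite mxdot_gt0 subr_eq0.
have cww : c * mxdot w w = 2 by rewrite /c divfK ?gt_eqF.
exists (1%:M - c *: (w *m w^T)); split.
- by rewrite linearB linearZ /= trmx1 trmx_mul trmxK.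
- set S := c *: _; have SS : S *m S = 2 *: S.
    rewrite /S -scalemxAl -scalemxAr mulmxA -(mulmxA w) scalar_mxdot.
    by rewrite mul_mx_scalar -scalemxAl !scalerA -cww; congr (_ *: _); ring.
  rewrite mulmxBl mul1mx mulmxBr mulmx1 SS scaler_nat mulr2n.
  by rewrite opprB addrK subrK.
- rewrite -/e mulmxBl mul1mx -scalemxAl -mulmxA scalar_mxdot mul_mx_scalar scalerA.
  have -> : c * mxdot w e = 1.
    have ww : mxdot w w = 2 * mxdot w e.
      by rewrite /w !(mxdotBl, mxdotBr) e1 v1 (mxdotC e v); ring.
    by move: cww; rewrite ww => cwe; lra.
  by rewrite scale1r /w opprB addrC subrK.
Qed.

(** Conjugation by the reflection turns the first column into a multiple of the first basis vector.
    Symmetry clears the first row too, and induction treats the remaining block. *)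
Lemma symmetric_diagonalization n (B : 'M[R]_n) : B^T = B ->
  exists (V : 'M[R]_n) (d : 'rV[R]_n),
    V^T *m V = 1%:M /\ B = V *m diag_mx d *m V^T.
Proof.
elim: n B => [|n IHn] B B_sym.
  exists 1%:M, 0; split; first by rewrite trmx1 mulmx1.
  by apply/matrixP => -[].
have [a [v [v1 Bv]]] := symmetric_eigenvector B_sym.
have [Q [Q_sym QQ Qe]] := orthogonal_first_column v1.
have QCQ : Q *m (Q *m B *m Q) *m Q = B.
  by rewrite !mulmxA QQ mul1mx -mulmxA QQ mulmx1.
pose C : 'M[R]_(1 + n) := Q *m B *m Q.
have C_sym : C^T = C by rewrite /C !trmx_mul Q_sym B_sym mulmxA.
have C0 : (C : 'M[R]_n.+1) *m delta_mx 0 0 = a *: (delta_mx 0 0 : 'cV[R]_n.+1).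
  by rewrite /C -mulmxA Qe -mulmxA Bv -scalemxAr -Qe mulmxA QQ mul1mx.
have dl : dlsubmx C = 0.
  apply/matrixP => i j; rewrite !mxE ord1.
  have /matrixP /(_ (rshift 1 i) 0) := C0.
  rewrite -colE !mxE /= => e.
  rewrite (_ : lshift n 0 = 0) ?e ?mulr0 //; exact/val_inj.
have ur : ursubmx C = 0 by rewrite -[C]C_sym -trmx_dlsub dl trmx0.
have ul : ulsubmx C = a%:M.
  apply/matrixP => i j; rewrite !mxE !ord1.
  have /matrixP /(_ 0 0) := C0; rewrite -colE !mxE /= mulr1 => e.
  rewrite (_ : lshift n 0 = 0) ?e //; exact/val_inj.
have D_sym : (drsubmx C)^T = drsubmx C by rewrite trmx_drsub C_sym.
have [V [d [VV DV]]] := IHn _ D_sym.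
have CE : C = block_mx a%:M 0 0 (drsubmx C) by rewrite -{1}[C]submxK ul ur dl.
pose W : 'M[R]_(1 + n) := block_mx 1%:M 0 0 V.
pose d' : 'rV[R]_(1 + n) := row_mx (a%:M) d.
have WW : W^T *m W = 1%:M.
  rewrite /W tr_block_mx !trmx0 trmx1 mulmx_block !mulmx0 !mul0mx mulmx1 VV.
  by rewrite !addr0 !add0r -scalar_mx_block.
have CW : C = W *m diag_mx d' *m W^T.
  rewrite CE DV /W /d' diag_mx_row !tr_block_mx !mulmx_block.
  rewrite !trmx0 trmx1 !mulmx0 !mul0mx !mulmx1 !mul1mx !addr0 !add0r.
  by congr block_mx; rewrite ?mul0mx //; apply/matrixP => i j; rewrite !mxE !ord1 eqxx.
exists (Q *m W), d'; split.
  by rewrite trmx_mul Q_sym mulmxA -(mulmxA W^T Q) QQ mulmx1 WW.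
rewrite -[LHS]QCQ -/C CW trmx_mul Q_sym !mulmxA //.
Qed.

End RealSpectralTheorem.

(** * Singular values, operator bounds and norm duality *)

Section SchattenNorms.
Variable R : realType.
Implicit Types m n p : nat.

Lemma char_poly_diagonalization n (V : 'M[R]_n) (d : 'rV[R]_n) :
  V^T *m V = 1%:M ->
  char_poly (V *m diag_mx d *m V^T) = \prod_j ('X - (d 0 j)%:P).
Proof.
move=> /mulmx1C VV.
pose VP := map_mx (@polyC R) V.
have VPV : VP *m VP^T = 1%:M by rewrite /VP map_trmx -map_mxM VV map_mx1.
have -> : char_poly (V *m diag_mx d *m V^T) = char_poly (diag_mx d).
  rewrite /char_poly /char_poly_mx !map_mxM -map_trmx -/VP.
  rewrite (_ : 'X%:M - _ = VP *m ('X%:M - map_mx polyC (diag_mx d)) *m VP^T).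
    by rewrite !det_mulmx mulrAC -det_mulmx VPV det1 mul1r.
  by rewrite mulmxBr mulmxBl scalar_mxC -(mulmxA _ VP) VPV mulmx1.
rewrite char_poly_trig ?diag_mx_is_trig //.
by apply: eq_bigr => j _; rewrite mxE eqxx mulr1n.
Qed.

(** The sorted diagonal witnesses that the choice in [eigenvalues] is not the default; unique
    factorization into linear factors then fixes the multiset. *)
Lemma eigenvalues_diagonalization n (V : 'M[R]_n) (d : 'rV[R]_n) :
  V^T *m V = 1%:M ->
  perm_eq (eigenvalues (V *m diag_mx d *m V^T)) (codom (d 0)).
Proof.
move=> VV; pose B := V *m diag_mx d *m V^T.
have [_ sE] : [set s : seq R | sorted >=%R s /\
    char_poly B = \prod_(x <- s) ('X - x%:P)] (eigenvalues B).
  apply: xgetPex; exists (sort >=%R (codom (d 0))); split.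
    exact: (sort_sorted (@ge_total _ R)).
  rewrite (perm_big (codom (d 0))) ?perm_sort //.
  by rewrite big_image char_poly_diagonalization.
apply: prod_XsubC_eq; rewrite -sE.
by rewrite big_image char_poly_diagonalization.
Qed.

Lemma mxdot_mulmx_diag m n (A : 'M[R]_(m, n)) (V : 'M[R]_n) d (x : 'cV[R]_n) :
  A^T *m A = V *m diag_mx d *m V^T ->
  mxdot (A *m x) (A *m x) = \sum_j d 0 j * (V^T *m x) j 0 ^+ 2.
Proof.
move=> AA; rewrite mxdot_mull mulmxA AA -!mulmxA -{1}[V]trmxK -mxdot_mull.
rewrite mxdotE; apply: eq_bigr => j _; rewrite big_ord1 mul_diag_mx [in X in _ * X]mxE.
by rewrite mulrCA -expr2.
Qed.

(* The columns of [V] are right singular vectors of [A]. *)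
Lemma singular_basis m n (A : 'M[R]_(m, n)) :
  exists (V : 'M[R]_n) (s : 'I_n -> R),
    [/\ V^T *m V = 1%:M, A^T *m A = V *m diag_mx (\row_j s j ^+ 2) *m V^T,
        forall j, 0 <= s j & perm_eq (singular_values A) (codom s)].
Proof.
have AA_sym : (A^T *m A)^T = A^T *m A by rewrite trmx_mul trmxK.
have [V [d [VV AA]]] := symmetric_diagonalization AA_sym.
exists V, (fun j => Num.sqrt (d 0 j)).
(* The eigenvalue [d_j] equals [|A v_j|^2] for the column [v_j] of [V]. *)
have d_ge0 j : 0 <= d 0 j.
  have := mxdot_ge0 (A *m col j V).
  rewrite (mxdot_mulmx_diag _ AA) (_ : V^T *m col j V = delta_mx j 0); last first.
    by rewrite colE mulmxA VV mul1mx.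
  rewrite (bigD1 j) //= big1 ?addr0 => [|i ij]; rewrite !mxE.
    by rewrite !eqxx expr1n mulr1.
  by rewrite (negbTE ij) expr0n mulr0.
split => //.
- rewrite AA; congr (_ *m diag_mx _ *m _); apply/rowP => j.
  by rewrite mxE sqr_sqrtr.
- rewrite /singular_values AA /codom /image_mem (map_comp Num.sqrt (d 0)).
  exact/perm_map/eigenvalues_diagonalization.
Qed.

Lemma nuclear_normE m n (A : 'M[R]_(m, n)) (s : 'I_n -> R) :
  perm_eq (singular_values A) (codom s) -> nuclear_norm A = \sum_j s j.
Proof. by move=> As; rewrite /nuclear_norm (perm_big _ As) /= big_image. Qed.

Lemma spectral_norm_ge0 m n (A : 'M[R]_(m, n)) : 0 <= spectral_norm A.
Proof. exact: bigmax_ge_id. Qed.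

Lemma le_spectral_norm m n (A : 'M[R]_(m, n)) (s : 'I_n -> R) j :
  perm_eq (singular_values A) (codom s) -> s j <= spectral_norm A.
Proof.
move=> As; apply: (le_bigmax_seq _ (s j)) => //.
by rewrite (perm_mem As) codom_f.
Qed.

(** Positivity rules out that the maximum is merely its default value [0]. *)
Lemma spectral_norm_attained m n (A : 'M[R]_(m, n)) (s : 'I_n -> R) :
  perm_eq (singular_values A) (codom s) -> 0 < spectral_norm A ->
  exists j, s j = spectral_norm A.
Proof.
move=> As; rewrite /spectral_norm.
have : {subset singular_values A <= codom s} by move=> x; rewrite (perm_mem As).
elim: (singular_values A) => [|x l IHl] sub; first by rewrite big_nil ltxx.
rewrite big_cons maxEle; case: ifP => _ pos.
  by apply: IHl => // y yl; apply: sub; rewrite inE yl orbT.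
by have /codomP [j ->] := sub _ (mem_head _ _); exists j.
Qed.

(** An operator norm bound in squared form, which composes without recomputing singular values.
    Since only [c ^+ 2] enters, [c] and [- c] give the same bound. *)
Definition opnorm_le m n (c : R) (A : 'M[R]_(m, n)) :=
  forall x : 'cV[R]_n, mxdot (A *m x) (A *m x) <= c ^+ 2 * mxdot x x.

Lemma opnorm_leM m n p (a b : R) (A : 'M[R]_(m, n)) (B : 'M[R]_(n, p)) :
  opnorm_le a A -> opnorm_le b B -> opnorm_le (a * b) (A *m B).
Proof.
move=> Aa Bb x; rewrite -mulmxA (le_trans (Aa _)) // exprMn -[leRHS]mulrA.
by rewrite ler_wpM2l ?sqr_ge0.
Qed.

Lemma opnorm_leZ m n (a c : R) (A : 'M[R]_(m, n)) :
  opnorm_le c A -> opnorm_le (a * c) (a *: A).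
Proof.
move=> Ac x; rewrite -scalemxAl mxdotZl mxdotZr mulrA -expr2 exprMn -[leRHS]mulrA.
by rewrite ler_wpM2l ?sqr_ge0.
Qed.

(** With [y = A^T x], Cauchy-Schwarz gives [|y|^2 = <A y, x> <= c |y| |x|]; divide by [|y|]. *)
Lemma opnorm_le_tr m n (c : R) (A : 'M[R]_(m, n)) :
  0 <= c -> opnorm_le c A -> opnorm_le c A^T.
Proof.
move=> c_ge0 Ac x; set y := A^T *m x.
have [->|y_neq0] := eqVneq y 0; first by rewrite mxdot0r mulr_ge0 ?sqr_ge0 ?mxdot_ge0.
have yy : mxdot y y = mxdot (A *m y) x by rewrite mxdot_mull.
have le1 : mxdot y y <= (c * Num.sqrt (mxdot y y)) * Num.sqrt (mxdot x x).
  rewrite {1}yy; apply: mxdot_cauchy_schwarz; rewrite ?mulr_ge0 ?sqrtr_ge0 //.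
    by rewrite exprMn sqr_sqrtr ?mxdot_ge0 //; exact: Ac.
  by rewrite sqr_sqrtr ?mxdot_ge0.
have le2 : Num.sqrt (mxdot y y) <= c * Num.sqrt (mxdot x x).
  have y_gt0 : 0 < Num.sqrt (mxdot y y) by rewrite sqrtr_gt0 mxdot_gt0.
  by rewrite -(ler_pM2l y_gt0) -expr2 sqr_sqrtr ?mxdot_ge0 // mulrA (mulrC _ c).
rewrite -[leLHS]sqr_sqrtr ?mxdot_ge0 // -[mxdot x x]sqr_sqrtr ?mxdot_ge0 //.
by rewrite -exprMn ler_pXn2r ?nnegrE ?mulr_ge0 ?sqrtr_ge0.
Qed.

(** In the basis of right singular vectors, [|A x|^2] is the sum of the [s_j^2 x_j^2]. *)
Lemma opnorm_le_spectral m n (A : 'M[R]_(m, n)) : opnorm_le (spectral_norm A) A.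
Proof.
have [V [s [VV AA s_ge0 As]]] := singular_basis A => x.
rewrite (mxdot_mulmx_diag _ AA).
have -> : mxdot x x = \sum_j (V^T *m x) j 0 ^+ 2.
  rewrite -[x in LHS]mul1mx -(mulmx1C VV) -mulmxA mxdot_mull !mulmxA.
  rewrite VV mul1mx mxdotE.
  by apply: eq_bigr => j _; rewrite big_ord1 -expr2.
rewrite mulr_sumr; apply: ler_sum => j _; rewrite mxE ler_wpM2r ?sqr_ge0 //.
by rewrite ler_pXn2r ?nnegrE ?spectral_norm_ge0 // le_spectral_norm.
Qed.

Lemma mxdot_col m n (A B : 'M[R]_(m, n)) :
  mxdot A B = \sum_j mxdot (col j A) (col j B).
Proof.
rewrite mxdotE exchange_big; apply: eq_bigr => j _.
by rewrite mxdotE; apply: eq_bigr => i _; rewrite big_ord1 !mxE.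
Qed.

Lemma mxdot_orthonormal_basis m n (V : 'M[R]_n) (A B : 'M[R]_(m, n)) :
  V^T *m V = 1%:M ->
  mxdot A B = \sum_j mxdot (A *m col j V) (B *m col j V).
Proof.
move=> VV; rewrite -[B in LHS]mulmx1 -(mulmx1C VV) mulmxA -mxdot_mulr mxdot_col.
by apply: eq_bigr => j _; rewrite !colE !mulmxA.
Qed.

Lemma mxdot_singular_vector m n (A : 'M[R]_(m, n)) (V : 'M[R]_n) s j :
  V^T *m V = 1%:M -> A^T *m A = V *m diag_mx (\row_j s j ^+ 2) *m V^T ->
  mxdot (A *m col j V) (A *m col j V) = s j ^+ 2.
Proof.
move=> VV AA; rewrite (mxdot_mulmx_diag _ AA).
rewrite (_ : V^T *m col j V = delta_mx j 0); last by rewrite colE mulmxA VV mul1mx.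
rewrite (bigD1 j) //= big1 ?addr0 => [|i ij]; rewrite !mxE.
  by rewrite !eqxx expr1n mulr1.
by rewrite (negbTE ij) expr0n mulr0.
Qed.

Lemma mxdot_col_orthonormal n (V : 'M[R]_n) j :
  V^T *m V = 1%:M -> mxdot (col j V) (col j V) = 1.
Proof.
move=> VV; rewrite colE mxdot_mull mulmxA VV mul1mx.
rewrite mxdotE; under eq_bigr do rewrite big_ord1.
rewrite (bigD1 j) //= big1 ?addr0 => [|i ij]; rewrite !mxE.
  by rewrite !eqxx mulr1.
by rewrite (negbTE ij) mulr0.
Qed.

(** Half of the duality: over the right singular basis of [A], each term satisfies
    [<A v_j, B v_j> <= s_j c]. *)
Lemma mxdot_le_nuclear m n (c : R) (A B : 'M[R]_(m, n)) :
  0 <= c -> opnorm_le c B -> mxdot A B <= c * nuclear_norm A.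
Proof.
move=> c_ge0 Bc; have [V [s [VV AA s_ge0 As]]] := singular_basis A.
rewrite (mxdot_orthonormal_basis _ _ VV) (nuclear_normE As) mulr_sumr.
apply: ler_sum => j _; rewrite mulrC; apply: mxdot_cauchy_schwarz => //.
  by rewrite (mxdot_singular_vector _ VV AA).
by rewrite (le_trans (Bc _)) // mxdot_col_orthonormal // mulr1.
Qed.

(** Restricting the diagonal matrix to the support of [d] leaves an invertible submatrix of that
    size. *)
Lemma card_support_le_rank n (d : 'rV[R]_n) :
  (#|[pred j | (d 0 j != 0)%R]| <= \rank (diag_mx d))%N.
Proof.
set J := [pred j | _]; pose f (i : 'I_#|J|) : 'I_n := enum_val i.
pose D := mxsub f f (diag_mx d).
have <- : \rank D = #|J|.
  have -> : D = diag_mx (\row_i d 0 (f i)).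
    apply/matrixP => i j; rewrite !mxE (inj_eq enum_val_inj) //.
  rewrite mxrank_unit // unitmxE det_diag unitfE; apply/prodf_neq0 => i _.
  by rewrite mxE; have := enum_valP i.
have -> : D = rowsub f 1%:M *m diag_mx d *m colsub f 1%:M.
  by rewrite mul_rowsub_mx mul1mx mulmx_colsub mulmx1; apply/matrixP => i j; rewrite !mxE.
exact: leq_trans (mxrankM_maxl _ _) (mxrankM_maxr _ _).
Qed.

(** At most [\rank A] singular values are nonzero, and each is at most [c]. *)
Lemma nuclear_norm_le_rank m n (c : R) (A : 'M[R]_(m, n)) :
  0 <= c -> opnorm_le c A -> nuclear_norm A <= (\rank A)%:R * c.
Proof.
move=> c_ge0 Ac; have [V [s [VV AA s_ge0 As]]] := singular_basis A.
have s_le j : s j <= c.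
  rewrite -(ler_pXn2r (n := 2)) ?nnegrE // -(mxdot_singular_vector _ VV AA).
  by rewrite (le_trans (Ac _)) // mxdot_col_orthonormal // mulr1.
rewrite (nuclear_normE As) (bigID [pred j | s j != 0]) /= [X in _ + X]big1 ?addr0; last first.
  by move=> j /negPn /eqP.
apply: (@le_trans _ _ (\sum_(j | s j != 0) c)); first exact: ler_sum.
rewrite sumr_const -[_ *+ _]mulr_natl ler_wpM2r // ler_nat.
pose d : 'rV_n := \row_j s j ^+ 2.
rewrite (eq_card (B := [pred j | d 0 j != 0])) => [|j]; last first.
  by rewrite !inE mxE expf_eq0.
rewrite (leq_trans (card_support_le_rank d)) //.
have -> : diag_mx d = V^T *m A^T *m A *m V.
  by rewrite -(mulmxA V^T) AA !mulmxA VV mul1mx -mulmxA VV mulmx1.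
by rewrite (leq_trans (mxrankM_maxl _ _)) // mxrankM_maxr.
Qed.

(* [W] is the partial isometry of the polar decomposition of [A]; it norms [A]
   in the duality between the nuclear and the spectral norms. *)
Lemma polar_partial_isometry m n (A : 'M[R]_(m, n)) :
  exists W : 'M[R]_(m, n),
    [/\ W *m W^T *m A = A, A *m W^T *m W = A, W *m W^T *m W = W,
        mxdot W A = nuclear_norm A & (\rank W <= \rank A)%N].
Proof.
have [V [s [VV AA s_ge0 As]]] := singular_basis A.
(* As [0^-1 = 0], [e] inverts the nonzero singular values and keeps the others at zero; [b] marks
   the nonzero ones. *)
pose d : 'rV_n := \row_j s j ^+ 2; pose e : 'rV_n := \row_j (s j)^-1.
pose b : 'rV[R]_n := \row_j (s j != 0)%:R.
pose W := A *m V *m diag_mx e *m V^T.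
have AW : A^T *m W = V *m diag_mx (\row_j s j) *m V^T.
  rewrite /W !mulmxA AA -!mulmxA (mulmxA V^T V) VV mul1mx (mulmxA (diag_mx _)).
  congr (_ *m (_ *m _)); rewrite mulmx_diag; congr diag_mx.
  apply/rowP => j; rewrite !mxE; have [->|s_neq0] := eqVneq (s j) 0.
    by rewrite invr0 mulr0.
  by rewrite expr2 mulfK.
have WA : W^T *m A = V *m diag_mx (\row_j s j) *m V^T.
  by rewrite -[LHS]trmxK trmx_mul trmxK AW !trmx_mul trmxK tr_diag_mx mulmxA.
have AVb : A *m V *m diag_mx b = A *m V.
  apply/matrixP => i j; rewrite mul_mx_diag mxE [b 0 j]mxE.
  have [s0|_] := eqVneq (s j) 0; last by rewrite mulr1.
  have /eqP := mxdot_singular_vector j VV AA.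
  rewrite s0 expr0n mxdot_eq0 => /eqP /colP /(_ i).
  by rewrite colE mulmxA -colE !mxE => ->; rewrite mulr0.
have sb : diag_mx e *m diag_mx (\row_j s j) = diag_mx b.
  rewrite mulmx_diag; congr diag_mx; apply/rowP => j; rewrite !mxE.
  have [->|s_neq0] := eqVneq (s j) 0; first by rewrite mulr0.
  by rewrite mulVf.
have WWA : W *m W^T *m A = A.
  rewrite -mulmxA WA /W -!mulmxA (mulmxA V^T V) VV mul1mx (mulmxA (diag_mx e)).
  by rewrite sb !mulmxA AVb -mulmxA (mulmx1C VV) mulmx1.
have WW : W^T *m W = V *m diag_mx b *m V^T.
  rewrite {2}/W !mulmxA WA -!mulmxA (mulmxA V^T V) VV mul1mx.
  by rewrite (mulmxA (diag_mx _)) diag_mxC sb.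
exists W; split => //.
- by rewrite -mulmxA WW !mulmxA AVb -mulmxA (mulmx1C VV) mulmx1.
- have WE : W = A *m (V *m diag_mx e *m V^T) by rewrite /W !mulmxA.
  by rewrite {3}WE mulmxA WWA -WE.
- rewrite /mxdot WA -mulmxA mxtrace_mulC -mulmxA VV mulmx1 mxtrace_diag.
  by rewrite (nuclear_normE As); apply: eq_bigr => j _; rewrite mxE.
- by rewrite /W -!mulmxA mxrankM_maxl.
Qed.

(** Pythagoras for [x = Q x + (x - Q x)]. *)
Lemma opnorm_le_projection n (Q : 'M[R]_n) :
  Q^T = Q -> Q *m Q = Q -> opnorm_le 1 Q.
Proof.
move=> Q_sym QQ x; rewrite expr1n mul1r.
have -> : mxdot x x = mxdot (Q *m x) (Q *m x) + mxdot (x - Q *m x) (x - Q *m x).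
  rewrite !(mxdotBl, mxdotBr) (mxdotC x (Q *m x)) [mxdot (Q *m x) (Q *m x)]mxdot_mull.
  by rewrite Q_sym mulmxA QQ (mxdotC x); ring.
by rewrite lerDl mxdot_ge0.
Qed.

End SchattenNorms.

(** * Nuclear norm inequalities and deviations from a low-rank matrix *)

Section LowRank.
Variable R : realType.
Implicit Types m n p : nat.

Lemma opnorm_le_complement n (Q : 'M[R]_n) :
  Q^T = Q -> Q *m Q = Q -> opnorm_le 1 (1%:M - Q).
Proof.
move=> Q_sym QQ; apply: opnorm_le_projection.
  by rewrite linearB /= trmx1 Q_sym.
by rewrite mulmxBl mul1mx mulmxBr mulmx1 QQ subrr subr0.
Qed.

(** [W^T W] is an orthogonal projection and [|W x| = |W^T W x|]. *)
Lemma opnorm_le_partial_isometry m n (W : 'M[R]_(m, n)) :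
  W *m W^T *m W = W -> opnorm_le 1 W.
Proof.
move=> WWW; have PP : W^T *m W *m (W^T *m W) = W^T *m W.
  by rewrite mulmxA -(mulmxA W^T) -mulmxA WWW.
have P_sym : (W^T *m W)^T = W^T *m W by rewrite trmx_mul trmxK.
move=> x; apply: le_trans (opnorm_le_projection P_sym PP x).
by rewrite [leRHS]mxdot_mull P_sym [in leRHS]mulmxA PP mxdot_mull mulmxA.
Qed.

(** The polar isometry that norms [A + B] pairs with each summand to at most its nuclear norm. *)
Lemma nuclear_normD m n (A B : 'M[R]_(m, n)) :
  nuclear_norm (A + B) <= nuclear_norm A + nuclear_norm B.
Proof.
have [W [_ _ WWW <- _]] := polar_partial_isometry (A + B).
have W1 := opnorm_le_partial_isometry WWW.
rewrite mxdotDr !(mxdotC W) lerD // -[nuclear_norm _]mul1r.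
  exact: mxdot_le_nuclear.
exact: mxdot_le_nuclear.
Qed.

Lemma nuclear_norm_gt0 m n (A : 'M[R]_(m, n)) : A != 0 -> 0 < nuclear_norm A.
Proof.
move=> A_neq0; have A_ge0 := spectral_norm_ge0 A.
have le_nuc := mxdot_le_nuclear A A_ge0 (opnorm_le_spectral A).
have AA_gt0 : 0 < mxdot A A by rewrite mxdot_gt0.
rewrite ltNge; apply/negP => nuc_le0; have := mulr_ge0_le0 A_ge0 nuc_le0; lra.
Qed.

(** Moving [Q] onto the isometry [W] that norms [A Q] leaves [W Q^T], still a contraction. *)
Lemma nuclear_norm_mulr m n p (A : 'M[R]_(m, n)) (Q : 'M[R]_(n, p)) :
  opnorm_le 1 Q -> nuclear_norm (A *m Q) <= nuclear_norm A.
Proof.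
move=> Q1; have [W [_ _ WWW <- _]] := polar_partial_isometry (A *m Q).
have W1 := opnorm_le_partial_isometry WWW.
rewrite mxdotC mxdot_mulr -[leRHS]mul1r; apply: mxdot_le_nuclear => //.
rewrite -[1]mulr1; apply: opnorm_leM => //; exact: opnorm_le_tr.
Qed.

Lemma unit_rank_one m n (u : 'cV[R]_m) (v : 'cV[R]_n) :
  mxdot u u = 1 -> mxdot v v = 1 ->
  [/\ mxdot (u *m v^T) (u *m v^T) = 1, (\rank (u *m v^T) <= 1)%N,
      opnorm_le 1 (1%:M - v *m v^T) & opnorm_le 1 (u *m v^T)].
Proof.
move=> u1 v1.
have P_sym : (v *m v^T)^T = v *m v^T by rewrite trmx_mul trmxK.
have PP : v *m v^T *m (v *m v^T) = v *m v^T.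
  by rewrite -mulmxA (mulmxA v^T) scalar_mxdot v1 mul1mx.
split.
- rewrite mxdot_mull mulmxA scalar_mxdot u1 mul1mx mxdot_tr //.
- exact: mulmx_max_rank.
- exact: opnorm_le_complement.
- move=> x; apply: le_trans (opnorm_le_projection P_sym PP x).
  rewrite -!mulmxA scalar_mxdot !mul_mx_scalar !(mxdotZl, mxdotZr).
  by rewrite u1 v1.
Qed.

Lemma top_singular_vectors m n (A : 'M[R]_(m, n)) : 0 < spectral_norm A ->
  exists (u : 'cV[R]_m) (v : 'cV[R]_n),
    [/\ mxdot u u = 1, mxdot v v = 1 & A *m v = spectral_norm A *: u].
Proof.
move=> A_gt0; have [V [s [VV AA _ As]]] := singular_basis A.
have [j sj] := spectral_norm_attained As A_gt0.
exists ((spectral_norm A)^-1 *: (A *m col j V)), (col j V); split.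
- rewrite mxdotZl mxdotZr (mxdot_singular_vector _ VV AA) sj mulrA -invfM -expr2.
  by rewrite mulVf // expf_neq0 // gt_eqF.
- exact: mxdot_col_orthonormal.
- by rewrite scalerA mulfV ?scale1r // gt_eqF.
Qed.

(* If [A] is nearly no larger than [A0] in nuclear norm, then most of [A - A0]
   lives on matrices sharing a row or a column space with [A0], up to a block
   [Hp].  The functional [W] below, a subgradient of the nuclear norm at
   [A0], shows that [Hp] is controlled by the rest, which has rank <= 2 r. *)
Lemma nuclear_norm_low_rank_deviation m n (A A0 : 'M[R]_(m, n)) (r : nat) (c : R) :
  0 <= c -> (\rank A0 <= r)%N -> opnorm_le c (A - A0) ->
  nuclear_norm A <= nuclear_norm A0 + 2 / 3 * nuclear_norm (A - A0) ->
  nuclear_norm (A - A0) <= 9 * r%:R * c.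
Proof.
(* The first two bounds give [hp <= rc + 2/3 h], the others [h <= 2 rc + hp]; hence [h / 3 <= 3 rc],
   the source of the constant 9. *)
have arith (h a b hp q x x0 rc : R) : x0 - rc + hp <= x -> x <= x0 + 2 / 3 * h ->
  a <= rc -> b <= rc -> q <= b + hp -> h <= a + q -> h <= 9 * rc by lra.
move=> c_ge0 rank_A0; set H := A - A0 => Hc nuc_le.
have [W0 [W0A0 A0W0 WWW W0nuc W0rank]] := polar_partial_isometry A0.
have W0_le1 := opnorm_le_partial_isometry WWW.
pose P1 := W0 *m W0^T; pose P2 := W0^T *m W0.
have P1_sym : P1^T = P1 by rewrite /P1 trmx_mul trmxK.
have P2_sym : P2^T = P2 by rewrite /P2 trmx_mul trmxK.
have P1P1 : P1 *m P1 = P1 by rewrite /P1 mulmxA WWW.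
have P2P2 : P2 *m P2 = P2 by rewrite /P2 mulmxA -(mulmxA W0^T) -mulmxA WWW.
pose Q1 := 1%:M - P1; pose Q2 := 1%:M - P2.
have Q1_sym : Q1^T = Q1 by rewrite linearB /= trmx1 P1_sym.
have Q2_sym : Q2^T = Q2 by rewrite linearB /= trmx1 P2_sym.
have Q2Q2 : Q2 *m Q2 = Q2 by rewrite mulmxBl mul1mx mulmxBr mulmx1 P2P2 subrr subr0.
have Q1_le1 : opnorm_le 1 Q1 by exact: opnorm_le_complement.
have P1_le1 : opnorm_le 1 P1 by exact: opnorm_le_projection.
have P2_le1 : opnorm_le 1 P2 by exact: opnorm_le_projection.
have Q1W0 : Q1 *m W0 = 0 by rewrite mulmxBl mul1mx WWW subrr.
have Q1A0 : Q1 *m A0 = 0 by rewrite mulmxBl mul1mx W0A0 subrr.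
pose Hp := Q1 *m H *m Q2.
have [W1 [_ _ WWW1 W1nuc _]] := polar_partial_isometry Hp.
have W1_le1 := opnorm_le_partial_isometry WWW1.
pose W := W0 + Q1 *m W1 *m Q2.
(* The two summands of [W] have orthogonal ranges, and [|W0 x|^2 + |Q2 x|^2 = |x|^2]. *)
have W_le1 : opnorm_le 1 W.
  move=> x; rewrite expr1n mul1r mulmxDl mxdotDl !mxdotDr.
  have cross y : mxdot (W0 *m x) (Q1 *m y) = 0.
    by rewrite mxdotC mxdot_mull Q1_sym mulmxA Q1W0 mul0mx mxdot0r.
  rewrite (mxdotC (Q1 *m W1 *m Q2 *m x)) -!(mulmxA Q1) !cross addr0 add0r !mulmxA.
  have -> : mxdot x x = mxdot (W0 *m x) (W0 *m x) + mxdot (Q2 *m x) (Q2 *m x).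
    rewrite mxdot_mull mulmxA [mxdot (Q2 *m x) _]mxdot_mull Q2_sym mulmxA Q2Q2.
    by rewrite -mxdotDr -mulmxDl addrC subrK mul1mx.
  have QW : opnorm_le 1 (Q1 *m W1) by rewrite -[1]mulr1; exact: opnorm_leM.
  by rewrite lerD2l; have := QW (Q2 *m x); rewrite expr1n mul1r mulmxA.
have WA0 : mxdot W A0 = nuclear_norm A0.
  rewrite mxdotDl W0nuc -mulmxA mxdot_mull Q1_sym Q1A0 mxdot0r addr0 //.
have W1H : mxdot (Q1 *m W1 *m Q2) H = nuclear_norm Hp.
  by rewrite mxdot_mulr mxdot_mull Q1_sym Q2_sym mulmxA.
have rank_le (B : 'M[R]_(m, n)) : (\rank B <= \rank W0)%N -> opnorm_le c B ->
    nuclear_norm B <= r%:R * c.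
  move=> rkB Bc; rewrite (le_trans (nuclear_norm_le_rank c_ge0 Bc)) // ler_wpM2r //.
  by rewrite ler_nat (leq_trans rkB) // (leq_trans W0rank).
(* Duality with the roles exchanged: [W0] has nuclear norm at most [r], and [c] bounds [- H]. *)
have W0H : - (r%:R * c) <= mxdot W0 H.
  rewrite lerNl -mxdotNr mulrC.
  have NHc : opnorm_le c (- H) by move=> x; rewrite mulNmx mxdotNl mxdotNr opprK.
  apply: (le_trans (mxdot_le_nuclear W0 c_ge0 NHc)); rewrite ler_wpM2l //.
  apply: (le_trans (nuclear_norm_le_rank ler01 W0_le1)); rewrite mulr1 ler_nat.
  exact: leq_trans rank_A0.
have WA : mxdot W A <= nuclear_norm A.
  by rewrite mxdotC -[leRHS]mul1r; exact: mxdot_le_nuclear.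
have Hp_le : nuclear_norm A0 - r%:R * c + nuclear_norm Hp <= nuclear_norm A.
  apply: le_trans WA; rewrite (_ : A = A0 + H) /H; last by rewrite addrC subrK.
  by rewrite mxdotDr WA0 -/H /W mxdotDl W1H -addrA lerD2l lerD2r.
have PH_le : nuclear_norm (P1 *m H) <= r%:R * c.
  apply: rank_le; first by rewrite /P1 -!mulmxA mxrankM_maxl.
  by rewrite -[c]mul1r; exact: opnorm_leM.
have QHP_le : nuclear_norm (Q1 *m H *m P2) <= r%:R * c.
  apply: rank_le; first by rewrite /P2 !mulmxA mxrankM_maxr.
  by rewrite -[c]mulr1 -[X in X * 1]mul1r; do 2?apply: opnorm_leM.
have HE : H = P1 *m H + (Q1 *m H *m P2 + Hp).
  have PQ1 : P1 + Q1 = 1%:M by rewrite addrC subrK.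
  have PQ2 : P2 + Q2 = 1%:M by rewrite addrC subrK.
  by rewrite /Hp -mulmxDr PQ2 mulmx1 -mulmxDl PQ1 mul1mx.
rewrite -mulrA; apply: arith Hp_le nuc_le PH_le QHP_le (nuclear_normD _ _) _.
by rewrite [X in nuclear_norm X <= _]HE nuclear_normD.
Qed.

End LowRank.

Lemma nuclear_norm_ge0 (R : realType) m n (A : 'M[R]_(m, n)) : 0 <= nuclear_norm A.
Proof.
by rewrite /nuclear_norm big_map; apply: sumr_ge0 => x _; exact: sqrtr_ge0.
Qed.

(** * Mixed second moments of one random matrix *)

Section SecondMoments.
Context (R : realType) (d : measure_display) (T : measurableType d).
Context (P : probability T R) (m1 m2 : nat) (Z : T -> 'M[R]_(m1, m2)).
Hypothesis Z_meas : forall j k, measurable_fun setT (fun w => Z w j k).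
Hypothesis Z_moment2 : forall A : 'M[R]_(m1, m2),
  ('E_P[(fun w => (mxdot A (Z w) ^+ 2)%R)] < +oo)%E.

Let prod_moment (A B : 'M[R]_(m1, m2)) : R :=
  fine 'E_P[(fun w => mxdot A (Z w) * mxdot B (Z w))].

Lemma measurable_mxdot (A : 'M[R]_(m1, m2)) :
  measurable_fun setT (fun w => mxdot A (Z w)).
Proof.
under eq_fun do rewrite mxdotE.
apply: measurable_sum => j; apply: measurable_sum => k.
by apply: measurable_funM => //; exact: measurable_cst.
Qed.

(** The product is dominated through [|a b| <= a^2 + b^2] by two integrable squares. *)
Lemma integrable_mxdotM (A B : 'M[R]_(m1, m2)) :
  P.-integrable setT (EFin \o (fun w => mxdot A (Z w) * mxdot B (Z w))).
Proof.
have sqr_int (C : 'M[R]_(m1, m2)) :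
    P.-integrable setT (EFin \o (fun w => mxdot C (Z w) ^+ 2)).
  apply/integrableP; split.
    by apply/measurable_EFinP/measurable_funX/measurable_mxdot.
  have := Z_moment2 C; rewrite unlock; apply: le_lt_trans.
  rewrite le_eqVlt; apply/orP; left; apply/eqP; apply: eq_integral => w _ /=.
  by rewrite ger0_norm ?sqr_ge0.
apply: (le_integrable measurableT _ _ (integrableD measurableT (sqr_int A) (sqr_int B))).
  by apply/measurable_EFinP/measurable_funM; exact: measurable_mxdot.
move=> w _ /=; rewrite lee_fin normrM [leRHS]ger0_norm ?addr_ge0 ?sqr_ge0 //.
have amgm (a b : R) : 0 <= a -> 0 <= b -> a * b <= a ^+ 2 + b ^+ 2.
  by move=> a_ge0 b_ge0; have := sqr_ge0 (a - b); nra.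
by rewrite (le_trans (amgm _ _ _ _)) // !real_normK ?num_real.
Qed.

Lemma prod_momentE A B :
  prod_moment A B = \int[P]_w (mxdot A (Z w) * mxdot B (Z w)).
Proof. by rewrite /prod_moment unlock. Qed.

Lemma prod_momentDr A B C : prod_moment A (B + C) = prod_moment A B + prod_moment A C.
Proof.
rewrite !prod_momentE -RintegralD //; try exact: integrable_mxdotM.
by congr Rintegral; apply/funext => w; rewrite mxdotDl mulrDr.
Qed.

Lemma prod_momentZr A a B : prod_moment A (a *: B) = a * prod_moment A B.
Proof.
rewrite !prod_momentE -RintegralZl //; last exact: integrable_mxdotM.
by congr Rintegral; apply/funext => w; rewrite mxdotZl mulrCA.
Qed.

(** Used to pair the centering term of [noise_matrix2] with [B]: by linearity in [B], entrywise
    expectation commutes with the pairing. *)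
Lemma prod_moment_entries A B :
  mxdot (\matrix_(j, k) fine 'E_P[(fun v => (mxdot A (Z v) *: Z v) j k)]) B =
  prod_moment A B.
Proof.
have e0 : prod_moment A 0 = 0 by rewrite -(scale0r 0) prod_momentZr mul0r.
have add := big_morph (prod_moment A) (prod_momentDr A) e0.
rewrite mxdotE [in RHS](matrix_sum_delta B) add; apply: eq_bigr => j _.
rewrite add; apply: eq_bigr => k _; rewrite prod_momentZr mulrC mxE.
congr (_ * fine _); congr expectation; apply/funext => w.
rewrite mxE; congr (_ * _); rewrite mxdotE (bigD1 j) //= (bigD1 k) //=.
rewrite big1 => [|k' kk']; last by rewrite mxE (negbTE kk') andbF mul0r.
rewrite big1 => [|j' jj']; first by rewrite mxE !eqxx mul1r !addr0.
by rewrite big1 // => k' _; rewrite mxE (negbTE jj') mul0r.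
Qed.

End SecondMoments.

(** * The population inner product and the penalized objective *)

Section TraceRegression.
Context (R : realType) (d : measure_display) (T : measurableType d).
Context (P : probability T R) (n m1 m2 : nat) (X : 'I_n -> T -> 'M[R]_(m1, m2)).
Hypothesis X_meas : forall i j k, measurable_fun setT (fun w => X i w j k).
Hypothesis X_moment2 : forall (A : 'M[R]_(m1, m2)) i,
  ('E_P[(fun w => (mxdot A (X i w) ^+ 2)%R)] < +oo)%E.

Lemma L2dotC A B : L2dot P X A B = L2dot P X B A.
Proof.
congr (_ * _); apply: eq_bigr => i _; congr (fine (expectation _ _)).
by apply/funext => w; rewrite mulrC.
Qed.

Lemma L2dotDr A B C : L2dot P X A (B + C) = L2dot P X A B + L2dot P X A C.
Proof.
rewrite -mulrDr -big_split; congr (_ * _); apply: eq_bigr => i _.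
by apply: prod_momentDr => // A'; exact: X_moment2.
Qed.

Lemma L2dotZr A a B : L2dot P X A (a *: B) = a * L2dot P X A B.
Proof.
rewrite mulrCA mulr_sumr; congr (_ * _); apply: eq_bigr => i _.
by apply: prod_momentZr => // A'; exact: X_moment2.
Qed.

Lemma L2dotDl A B C : L2dot P X (B + C) A = L2dot P X B A + L2dot P X C A.
Proof. by rewrite L2dotC L2dotDr !(L2dotC A). Qed.

Lemma L2dotZl A a B : L2dot P X (a *: B) A = a * L2dot P X B A.
Proof. by rewrite L2dotC L2dotZr (L2dotC A). Qed.

Lemma L2dotBl A B C : L2dot P X (B - C) A = L2dot P X B A - L2dot P X C A.
Proof. by rewrite L2dotDl -scaleN1r L2dotZl mulN1r. Qed.

Lemma L2dot_ge0 A : 0 <= L2dot P X A A.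
Proof.
rewrite mulr_ge0 ?invr_ge0 ?ler0n //; apply: sumr_ge0 => i _.
by rewrite fine_ge0 // expectation_ge0 // => w; rewrite -expr2 sqr_ge0.
Qed.

Lemma L2norm_sqr A : L2norm P X A ^+ 2 = L2dot P X A A.
Proof. by rewrite sqr_sqrtr ?L2dot_ge0. Qed.

Lemma kappa1_sqr_le (B : 'M[R]_(m1, m2)) :
  0 < kappa1 P X -> mxdot B B = 1 -> (\rank B <= 1)%N ->
  kappa1 P X ^+ 2 <= L2dot P X B B.
Proof.
move=> kappa1_gt0 B1 rkB; rewrite -L2norm_sqr ler_pXn2r ?nnegrE ?sqrtr_ge0 ?(ltW kappa1_gt0) //.
rewrite /kappa1; apply: ge_inf; first by exists 0 => _ [C _ <-]; exact: sqrtr_ge0.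
by exists B => //; split => //; rewrite /frobenius_norm B1 sqrtr1.
Qed.

(** Zero matrices, left out of the supremum, make the left side vanish. *)
Lemma coherence_bound (c : R) (A B : 'M[R]_(m1, m2)) :
  0 <= c -> (coherence P X <= c%:E)%E -> mxdot A B = 0 ->
  `|L2dot P X A B| <= c * (nuclear_norm A * nuclear_norm B).
Proof.
move=> c_ge0 /ereal_supP coh AB.
have [->|A_neq0] := eqVneq A 0.
  by rewrite -(scale0r 0) L2dotZl mul0r normr0 !mulr_ge0 ?nuclear_norm_ge0.
have [->|B_neq0] := eqVneq B 0.
  by rewrite -(scale0r 0) L2dotZr mul0r normr0 !mulr_ge0 ?nuclear_norm_ge0.
rewrite -ler_pdivrMr ?mulr_gt0 ?nuclear_norm_gt0 // -lee_fin.
by apply: coh; exists (A, B).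
Qed.

Variables (Y xi : 'I_n -> T -> R) (A0 : 'M[R]_(m1, m2)) (lambda : R) (w : T).
Hypothesis model : forall i w, Y i w = \tr ((X i w)^T *m A0) + xi i w.

Let M := noise_matrix1 X xi w + noise_matrix2 P X A0 w.

(** By the model, [Y_i X_i] is noise plus centered design plus mean; the first two average to [M],
    and the mean contributes the population inner product with [A0]. *)
Lemma penalized_riskE A :
  penalized_risk P X Y lambda w A =
  L2dot P X A A - 2 * (mxdot M A + L2dot P X A0 A) + lambda * nuclear_norm A.
Proof.
rewrite /penalized_risk L2norm_sqr; congr (_ - _ + _).
rewrite mxdotZl -mulrA; congr (_ * _).
rewrite mxdotDl !mxdotZl /L2dot -!mulrDr; congr (_ * _).
rewrite !mxdot_suml -!big_split; apply: eq_bigr => i _ /=.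
rewrite !(mxdotZl, mxdotBl) (prod_moment_entries (X_meas i) (X_moment2^~ i)).
by rewrite model -[\tr _]/(mxdot (X i w) A0) (mxdotC (X i w) A0); ring.
Qed.

(** With [H = A - A0], the objective at [A] exceeds that at [A0] by [|H|_L2^2 - 2 <M, H> + lambda
    (|A|_1 - |A0|_1)], while [<M, H> <= lambda / 3 |H|_1]. *)
Lemma argmin_nuclear_norm_le A :
  0 < lambda -> 3 * spectral_norm M <= lambda ->
  is_argmin (penalized_risk P X Y lambda w) A ->
  nuclear_norm A <= nuclear_norm A0 + 2 / 3 * nuclear_norm (A - A0).
Proof.
move=> lambda_gt0 M_le /(_ A0).
have : A = A0 + (A - A0) by rewrite addrC subrK.
move: (A - A0) => H HE.
have MH : mxdot H M <= spectral_norm M * nuclear_norm H.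
  apply: mxdot_le_nuclear (spectral_norm_ge0 _) _; exact: opnorm_le_spectral.
have MH' : spectral_norm M * nuclear_norm H <= lambda / 3 * nuclear_norm H.
  by rewrite ler_wpM2r ?nuclear_norm_ge0 // ler_pdivlMr // mulrC.
have LH := L2dot_ge0 H.
rewrite !penalized_riskE.
have -> : L2dot P X A A = L2dot P X A0 A0 + 2 * L2dot P X A0 H + L2dot P X H H.
  by rewrite HE L2dotDl !L2dotDr (L2dotC H A0); ring.
have -> : mxdot M A = mxdot M A0 + mxdot H M by rewrite HE mxdotDr (mxdotC M H).
have -> : L2dot P X A0 A = L2dot P X A0 A0 + L2dot P X A0 H by rewrite HE L2dotDr.
move: MH MH' LH lambda_gt0 => {HE M_le}.
move: (mxdot H M) (spectral_norm M) (nuclear_norm H) (nuclear_norm A)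
  (nuclear_norm A0) (L2dot P X A0 A0) (L2dot P X A0 H) (L2dot P X H H) (mxdot M A0).
move=> {H} mh sM nH nA nA0 l00 l0h lhh ma0 h1 h2 h3 h4 h5.
rewrite -(ler_pM2l h4); nra.
Qed.

(** Comparing [A] with [A - t E], where [|t E|_1 <= t], and letting [t] tend to 0 gives
    [2 <A - A0, E>_L2 <= 2 <M, E> + lambda]. As [<M, E> <= lambda / 3], the constant is
    [1/3 + 1/2 = 5/6]. *)
Lemma argmin_L2dot_le A E :
  0 <= lambda -> 3 * spectral_norm M <= lambda ->
  is_argmin (penalized_risk P X Y lambda w) A ->
  opnorm_le 1 E -> (\rank E <= 1)%N ->
  L2dot P X (A - A0) E <= 5 / 6 * lambda.
Proof.
move=> lambda_ge0 M_le A_min E_le1 E_rank.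
have nuc_le (t : R) : 0 <= t -> nuclear_norm (- t *: E) <= t.
  move=> t_ge0; have tE : opnorm_le t (- t *: E).
    by have := opnorm_leZ (- t) E_le1; rewrite /opnorm_le mulr1 sqrrN.
  apply: (le_trans (nuclear_norm_le_rank t_ge0 tE)); rewrite -[leRHS]mul1r.
  by rewrite ler_wpM2r // lern1 (leq_trans (mxrank_scale _ _)).
have nucE : nuclear_norm E <= 1.
  rewrite (le_trans (nuclear_norm_le_rank ler01 E_le1)) // mulr1.
  by rewrite -[leRHS]/(1%:R) ler_nat.
have ME : mxdot M E <= lambda / 3.
  rewrite mxdotC; apply: (le_trans (mxdot_le_nuclear E (spectral_norm_ge0 M) _)).
    exact: opnorm_le_spectral.
  apply: (@le_trans _ _ (spectral_norm M * 1)).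
    by rewrite ler_wpM2l ?spectral_norm_ge0.
  by rewrite mulr1 ler_pdivlMr // mulrC.
have LE := L2dot_ge0 E.
have first_order (t : R) : 0 < t ->
    2 * L2dot P X (A - A0) E <= t * L2dot P X E E + 2 * mxdot M E + lambda.
  move=> t_gt0; have := A_min (A + - t *: E); rewrite !penalized_riskE.
  have lam_nuc : lambda * nuclear_norm (A + - t *: E) <=
      lambda * (nuclear_norm A + t).
    rewrite ler_wpM2l // (le_trans (nuclear_normD _ _)) // lerD2l.
    exact/nuc_le/ltW.
  rewrite L2dotBl !(L2dotDl, L2dotDr, L2dotZl, L2dotZr, mxdotDr, mxdotZr) (L2dotC E A).
  move=> le0.
  rewrite -(ler_pM2l t_gt0); move: lam_nuc le0; clear.
  move: (nuclear_norm _) (nuclear_norm A) (L2dot P X A A) (L2dot P X A E)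
    (L2dot P X E E) (mxdot M A) (mxdot M E) (L2dot P X A0 A) (L2dot P X A0 E).
  move=> n1 n2 x1 x2 x3 x4 x5 x6 x7; nra.
(* In place of a limit: if the inequality fails by [D > 0], then [t = D / (|E|_L2^2 + 1)] makes
   [t |E|_L2^2 < D], a contradiction. *)
have {first_order} : 2 * L2dot P X (A - A0) E <= 2 * mxdot M E + lambda.
  rewrite leNgt; apply/negP => lt0.
  set D := 2 * L2dot P X (A - A0) E - (2 * mxdot M E + lambda).
  have D_gt0 : 0 < D by rewrite subr_gt0.
  have LE1 : 0 < L2dot P X E E + 1 by rewrite ltr_wpDl.
  have [t t_gt0 tE] : exists2 t, 0 < t & t * (L2dot P X E E + 1) = D.
    by exists (D / (L2dot P X E E + 1)); [rewrite divr_gt0|rewrite divfK ?gt_eqF].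
  have := first_order t t_gt0; move: t_gt0 tE; rewrite /D.
  by move: (L2dot P X (A - A0) E) (L2dot P X E E) (mxdot M E) => x1 x2 x3; lra.
by move: ME; move: (L2dot P X (A - A0) E) (mxdot M E) => x1 x2; lra.
Qed.

End TraceRegression.

(** * The self-bounding inequality and the final estimate *)

(** Solving for [s k] gives the factor [5/6 + (15/2) / (11 alpha - 9)]. Since
    [11 alpha - 9 >= 11 (alpha - 1)], it suffices that [6 q >= 15/2], that is [q >= 5/4]; the
    theorem takes [q] to be the square root of 2. *)
Lemma spectral_bound_arith (R : realFieldType) (alpha lambda k s q : R) :
  1 < alpha -> 0 < lambda -> 0 < k -> 5 / 4 <= q ->
  s * k <= 5 / 6 * lambda + 9 / (11 * alpha) * (s * k) ->
  s <= (5 / 6 + 6 * q / (11 * (alpha - 1))) * (lambda / k).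
Proof.
move=> alpha_gt1 lambda_gt0 k_gt0 q_ge h; rewrite mulrA ler_pdivlMr //; move: h.
move: (s * k) => {s k k_gt0} x h.
have h' : 0 <= 55 * alpha * lambda + 54 * x - 66 * alpha * x.
  have -> : 55 * alpha * lambda + 54 * x - 66 * alpha * x =
      66 * alpha * (5 / 6 * lambda + 9 / (11 * alpha) * x - x) by field; lra.
  by rewrite mulr_ge0 ?subr_ge0 //; lra.
have -> : (5 / 6 + 6 * q / (11 * (alpha - 1))) * lambda =
    (55 * (alpha - 1) + 36 * q) * lambda / (66 * (alpha - 1)) by field; lra.
rewrite ler_pdivlMr; last by lra.
have ql : 5 / 4 * lambda <= q * lambda by rewrite ler_pM2r.
have [x_le|x_gt] := leP x (5 / 6 * lambda); last by lra.
have : (alpha - 1) * x <= (alpha - 1) * (5 / 6 * lambda) by rewrite ler_pM2l; lra.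
lra.
Qed.

Unset Implicit Arguments.

Theorem theorem1 (R : realType) (d : measure_display) (T : measurableType d)
    (P : probability T R) (n m1 m2 : nat)
    (n_gt0 : (0 < n)%N) (m1_gt0 : (0 < m1)%N) (m2_gt0 : (0 < m2)%N)
    (X : 'I_n -> T -> 'M[R]_(m1, m2)) (Y xi : 'I_n -> {RV P >-> R})
    (A0 : 'M[R]_(m1, m2))
    (X_meas : forall i j k, measurable_fun setT (fun w => X i w j k))
    (X_moment2 : forall (A : 'M[R]_(m1, m2)) i,
       ('E_P[(fun w => (mxdot A (X i w) ^+ 2)%R)] < +oo)%E)
    (XY_indep : mutually_independent P (fun i => sigma_pair (X i) (Y i)))
    (xi_iid : iid xi)
    (xi_mean0 : forall i, ('E_P[xi i] = 0)%E)
    (xi_var : forall i, ('V_P[xi i] < +oo)%E)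
    (model : forall i w, Y i w = \tr ((X i w)^T *m A0) + xi i w)
    (r : nat) (r_ge1 : (1 <= r)%N) (rank_A0 : (\rank A0 <= r)%N)
    (alpha : R) (alpha_gt1 : 1 < alpha)
    (kappa1_gt0 : 0 < kappa1 P X)
    (coherence_le :
       (coherence P X <= (kappa1 P X ^+ 2 / (11 * alpha * r%:R))%:E)%E)
    (lambda : R) (lambda_gt0 : 0 < lambda)
    (Ahat : T -> 'M[R]_(m1, m2)) :
  forall w : T,
    is_argmin (penalized_risk P X Y lambda w) (Ahat w) ->
    3 * spectral_norm (noise_matrix1 X xi w + noise_matrix2 P X A0 w)
      <= lambda ->
    spectral_norm (Ahat w - A0)
      <= (5 / 6 + 6 * Num.sqrt 2 / (11 * (alpha - 1)))
         * (lambda / kappa1 P X ^+ 2).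
Proof.
move=> w A_min M_le; set H := Ahat w - A0; set k := kappa1 P X.
set s := spectral_norm H.
have sqrt2 : 5 / 4 <= Num.sqrt 2 :> R.
  by rewrite -(ler_pXn2r (n := 2)) ?nnegrE ?sqrtr_ge0 // ?sqr_sqrtr //; lra.
apply: spectral_bound_arith => //; first by rewrite exprn_gt0.
have [s_gt0|s_le0] := ltP 0 s; last first.
  have -> : s = 0 by apply/eqP; rewrite eq_le s_le0 spectral_norm_ge0.
  by rewrite mul0r mulr0 addr0 mulr_ge0 // ltW.
have [u [v [u1 v1 Hv]]] := top_singular_vectors s_gt0.
have [E1 E_rank Q_le1 E_le1] := unit_rank_one u1 v1.
set E := u *m v^T in E1 E_rank E_le1.
pose Q := 1%:M - v *m v^T.
have HE : H = s *: E + H *m Q.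
  by rewrite /Q mulmxBr mulmx1 mulmxA Hv -scalemxAl -/E -/s addrC subrK.
have nucE : nuclear_norm E <= 1.
  rewrite (le_trans (nuclear_norm_le_rank ler01 E_le1)) // mulr1.
  by rewrite -[leRHS]/(1%:R) ler_nat.
have EQ : mxdot (H *m Q) E = 0.
  rewrite mxdot_mulr /Q linearB /= trmx1 trmx_mul trmxK mulmxBr mulmx1 /E.
  by rewrite -mulmxA (mulmxA v^T) scalar_mxdot v1 mul1mx subrr mxdot0r.
have nuc_H : nuclear_norm H <= 9 * r%:R * s.
  apply: nuclear_norm_low_rank_deviation => //; first exact: ltW.
    exact: opnorm_le_spectral.
  exact: (argmin_nuclear_norm_le X_meas X_moment2 model lambda_gt0 M_le A_min).
have LHE : L2dot P X H E <= 5 / 6 * lambda.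
  exact: (argmin_L2dot_le X_meas X_moment2 model (ltW lambda_gt0) M_le A_min).
have r_gt0 : 0 < r%:R :> R by rewrite ltr0n.
set c := _ / _ in coherence_le.
have c_ge0 : 0 <= c.
  by rewrite divr_ge0 ?sqr_ge0 // !mulr_ge0 // ltW // (lt_trans _ alpha_gt1).
(* The [r] in the bound on [|H|_1] cancels the [r] in the coherence assumption. *)
have LQE : - (9 / (11 * alpha) * (s * k ^+ 2)) <= L2dot P X (H *m Q) E.
  rewrite lerNl (le_trans (ler_norm _)) // normrN.
  rewrite (le_trans (coherence_bound X_meas X_moment2 c_ge0 coherence_le EQ)) //.
  have -> : 9 / (11 * alpha) * (s * k ^+ 2) = c * (9 * r%:R * s * 1).
    by rewrite /c; field; rewrite !gt_eqF // (lt_trans _ alpha_gt1).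
  rewrite ler_wpM2l // ler_pM ?nuclear_norm_ge0 //.
  by rewrite (le_trans _ nuc_H) // nuclear_norm_mulr.
have kE := kappa1_sqr_le kappa1_gt0 E1 E_rank.
have skE : s * k ^+ 2 <= s * L2dot P X E E by rewrite ler_pM2l.
(* Pairing the splitting of [H] with [E] gives [s k^2 <= s <E, E>_L2 = <H, E>_L2 - <H Q, E>_L2]. *)
move: LHE; rewrite HE (L2dotDl X_meas X_moment2) (L2dotZl X_meas X_moment2).
lra.
Qed.
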